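(* Let $n,d,r$ be positive integers with $r\ge 3$ and $n\ge 2d$. Then $Q_n^-(d,r)$ is a connected Cayley graph if and only if $dr\equiv 0\pmod n$.
   Context: $\mathbb{Z}_2^n=\{0,1\}^n$ with coordinatewise addition mod 2; $e_i$ is the $i$-th standard basis vector, subscripts read modulo $n$. The general recursive cube of rings $Q_n^-(d,r)$ is the simple graph with vertex set $\mathbb{Z}_2^n\times\{0,1,\dots,r-1\}$ in which $(a,x)$ and $(b,y)$ are adjacent iff either $a=b$ and $x\equiv y\pm1\pmod r$, or $x=y$ and $b=a+e_{i-dx}$ for some $1\le i\le d$. A graph is a Cayley graph if it is isomorphic to $\mathrm{Cay}(H,S)$ for some group $H$ and inverse-closed $S\subseteq H\setminus\{1\}$, where $u\sim v$ iff $u^{-1}v\in S$. *)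

(* Defs.v *)
From mathcomp Require Import all_boot all_fingroup.
Set Implicit Arguments. Unset Strict Implicit. Unset Printing Implicit Defensive.

(* Vertices of Q_n^-(d,r): Z_2^n x {0,...,r-1}; a vector of Z_2^n is a
   boolean function on 'I_n (coordinate k : 'I_n is the paper's coordinate k+1). *)
Definition qvert (n r : nat) : finType := ({ffun 'I_n -> bool} * 'I_r)%type.

Definition flip (n : nat) (a : {ffun 'I_n -> bool}) (j : nat) : {ffun 'I_n -> bool} :=
  [ffun k : 'I_n => xorb (a k) (val k == j)].

(* 0-indexed coordinate of e_{i - d x} (paper's i in 1..d, subscripts mod n):
   for i' = i - 1 in 0..d-1 this is (i' - d x) mod n. *)
Definition cidx (n d : nat) (i' x : nat) : nat :=
  (i' + (n - (d * x) %% n)) %% n.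

Definition qadj (n d r : nat) : rel (qvert n r) :=
  fun u v =>
    let: (a, x) := u in let: (b, y) := v in
    ((a == b) && ((val x == (val y).+1 %% r) || (val y == (val x).+1 %% r)))
    || ((x == y) && [exists i : 'I_d, b == flip a (cidx n d (val i) (val x))]).

Arguments qadj : clear implicits.

Definition connected_graph (T : finType) (e : rel T) : Prop :=
  forall u v : T, connect e u v.

Definition is_cayley_graph (T : finType) (e : rel T) : Prop :=
  exists (gT : finGroupType) (S : {set gT}),
    [/\ (1%g \notin S),
        (forall s, s \in S -> (s^-1)%g \in S) &
        exists f : T -> gT, bijective f /\
          forall u v, e u v = (((f u)^-1 * f v)%g \in S)].

(* Main.v *)
Require Import Defs.
From HB Require Import structures.
From mathcomp Require Import all_boot all_fingroup.
From Stdlib Require Import ZArith Lia.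
From mathcomp Require Import zify ssrZ.
Set Implicit Arguments. Unset Strict Implicit. Unset Printing Implicit Defensive.

(* If n divides d r, the shift of coordinates by d defines an action of Z_r on Z_2^n, and the graph is
   a Cayley graph of the resulting semidirect product; it is connected because the flip sets F_x of the
   r levels cover all n coordinates.

   Conversely, connectedness forces n <= d r. Suppose d r = q n + s with 0 < s < n, so that q > 0.
   The flip sets are consecutive intervals of length d going around Z_n, but passing from level r - 1
   to level 0 the pattern is off by s. With t = max(1, s / d) one has 2 t < r, two levels at distance
   less than t have disjoint flip sets, and at distance t the overlap of flip sets is strictly larger
   across this seam than away from it. Closed walks of length 2 t + 2 are short enough to see the
   overlaps at distance t and nothing else, hence there are strictly more of them at a vertex of level 0
   than at a vertex of level t, where they cannot cross the seam. So the graph is not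
   vertex-transitive, whereas Cayley graphs are. *)

(** * Flip coordinates modulo [n] and levels modulo [r], in integer arithmetic *)

Lemma cidx_lt n d i x : 0 < n -> cidx n d i x < n.
Proof. by move=> n0; rewrite /cidx ltn_mod. Qed.

Lemma cidx_Z n d i x : 0 < n ->
  exists q : Z, Z.of_nat (cidx n d i x) = (Z.of_nat i - Z.of_nat d * Z.of_nat x + q * Z.of_nat n)%Z.
Proof.
move=> n0; rewrite /cidx.
have h1 := divn_eq (i + (n - (d * x) %% n)) n.
have h2 := divn_eq (d * x) n.
have h3 : (d * x) %% n < n by rewrite ltn_mod.
set m := (i + _) in h1 *.
exists (1 + Z.of_nat ((d * x) %/ n) - Z.of_nat (m %/ n))%Z.
have hm : (Z.of_nat m = Z.of_nat i + Z.of_nat n - Z.of_nat ((d * x) %% n))%Z by rewrite /m; lia.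
have h2' : (Z.of_nat d * Z.of_nat x = Z.of_nat ((d * x) %/ n) * Z.of_nat n + Z.of_nat ((d * x) %% n))%Z.
  by rewrite -Nat2Z.inj_mul -[LHS]/(Z.of_nat (d * x)) {1}h2; lia.
have h1' : (Z.of_nat m = Z.of_nat (m %/ n) * Z.of_nat n + Z.of_nat (m %% n))%Z by lia.
lia.
Qed.

Lemma cidx_eqP n d i x j y : 0 < n ->
  cidx n d i x = cidx n d j y <->
  exists q : Z, (Z.of_nat i - Z.of_nat d * Z.of_nat x =
                 Z.of_nat j - Z.of_nat d * Z.of_nat y + q * Z.of_nat n)%Z.
Proof.
move=> n0.
have [q1 h1] := cidx_Z d i x n0; have [q2 h2] := cidx_Z d j y n0.
have l1 := cidx_lt d i x n0; have l2 := cidx_lt d j y n0.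
split=> [e | [q h]]; first by exists (q2 - q1)%Z; rewrite e in h1; lia.
have e : (Z.of_nat (cidx n d i x) - Z.of_nat (cidx n d j y) = (q + q1 - q2) * Z.of_nat n)%Z by lia.
have : (q + q1 - q2 = 0)%Z by nia.
by move=> e0; rewrite e0 in e; lia.
Qed.

Lemma lev_subproof r z : 0 < r -> Z.to_nat (z mod Z.of_nat r) < r.
Proof. by move=> r0; have := Z.mod_pos_bound z (Z.of_nat r); lia. Qed.

(** Indexing levels by all integers lets a walk be followed by its displacement. *)
Definition lev r (r0 : 0 < r) (z : Z) : 'I_r := Ordinal (lev_subproof z r0).

Arguments lev : simpl never.

Lemma levZ r (r0 : 0 < r) z : Z.of_nat (lev r0 z) = (z mod Z.of_nat r)%Z.
Proof. by have := Z.mod_pos_bound z (Z.of_nat r); rewrite /=; lia. Qed.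

Lemma lev_nonneg r (r0 : 0 < r) z : (0 <= z < Z.of_nat r)%Z -> Z.of_nat (lev r0 z) = z.
Proof. by move=> h; rewrite levZ Z.mod_small. Qed.

Lemma lev_neg r (r0 : 0 < r) z : (- Z.of_nat r <= z < 0)%Z ->
  Z.of_nat (lev r0 z) = (z + Z.of_nat r)%Z.
Proof.
by move=> h; rewrite levZ -(Z_mod_plus_full z 1) Z.mul_1_l Z.mod_small //; lia.
Qed.

Lemma lev_eqP r (r0 : 0 < r) z z' :
  reflect ((z - z') mod Z.of_nat r = 0)%Z (lev r0 z == lev r0 z').
Proof.
have rZ : (Z.of_nat r <> 0)%Z by lia.
apply: (iffP eqP) => [e | e].
  by rewrite Zminus_mod -!(levZ r0) e Z.sub_diag.
apply: val_inj; apply: Nat2Z.inj; rewrite -[LHS]/(Z.of_nat (lev r0 z)) -[RHS]/(Z.of_nat (lev r0 z')) !levZ.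
have -> : (z = z' + (z - z'))%Z by lia.
by rewrite Zplus_mod e Z.add_0_r Zmod_mod.
Qed.

Lemma modn_Z m n : 0 < n -> Z.of_nat (m %% n) = (Z.of_nat m mod Z.of_nat n)%Z.
Proof.
move=> n0; apply: (Z.mod_unique_pos _ _ (Z.of_nat (m %/ n))); have := ltn_pmod m n0.
  by lia.
by have := divn_eq m n; lia.
Qed.

Lemma flipK n (a : {ffun 'I_n -> bool}) j : flip (flip a j) j = a.
Proof. by apply/ffunP=> k; rewrite !ffunE; case: (a k); case: (_ == _). Qed.

Lemma flip_inj n (a : {ffun 'I_n -> bool}) i j : i < n -> flip a i = flip a j -> i = j.
Proof.
move=> li /ffunP /(_ (Ordinal li)); rewrite !ffunE eqxx /=.
by case: (a _); case: eqP.
Qed.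

Lemma flip_neq n (a : {ffun 'I_n -> bool}) i : i < n -> flip a i <> a.
Proof. by move=> li /ffunP /(_ (Ordinal li)); rewrite !ffunE eqxx; case: (a _). Qed.

(** * Walk counts and automorphisms *)

Fixpoint nwalks (T : finType) (e : rel T) k u v : nat :=
  if k is k'.+1 then \sum_(w | e u w) nwalks e k' w v else u == v.

Lemma nwalks_aut (T : finType) (e : rel T) (h : T -> T) k u v :
  bijective h -> (forall x y, e (h x) (h y) = e x y) ->
  nwalks e k (h u) (h v) = nwalks e k u v.
Proof.
move=> hb he; elim: k u => [|k IH] u /=; first by rewrite (bij_eq hb).
rewrite (reindex h); last exact: onW_bij.
by apply: eq_big => w; rewrite ?he.
Qed.

(** Left translation by [f v * (f u)^-1], transported along [f], is an automorphism taking [u] to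
    [v]. *)
Lemma cayley_nwalks (T : finType) (e : rel T) k u v :
  is_cayley_graph e -> nwalks e k u u = nwalks e k v v.
Proof.
case=> gT [S [_ _ [f [[g fK gK] eE]]]].
pose h w := g (f v * (f u)^-1 * f w)%g.
have hu : h u = v by rewrite /h mulgKV fK.
rewrite -{1 2}hu; apply/esym/nwalks_aut.
  exists (fun w => g ((f v * (f u)^-1)^-1 * f w)%g) => w; rewrite /h gK.
    by rewrite mulKg fK.
  by rewrite mulKVg fK.
by move=> x y; rewrite !eE /h !gK invMg -mulgA mulKg.
Qed.

(** * Enumeration of the neighbours of a vertex *)

Lemma cidx_inj n d x : 0 < n -> d <= n -> injective (fun i : 'I_d => cidx n d i x).
Proof.
move=> n0 dn i j /(cidx_eqP _ _ _ _ _ n0) [q h].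
have := ltn_ord i; have := ltn_ord j => hj hi.
have [q0|[q1|q1]] : (q = 0 \/ q >= 1 \/ q <= -1)%Z by lia.
- by apply: val_inj => /=; rewrite q0 in h; lia.
- have : (q * Z.of_nat n >= Z.of_nat n)%Z by nia.
  lia.
have : (q * Z.of_nat n <= - Z.of_nat n)%Z by nia.
lia.
Qed.

Section Neighbours.
Variables (n d r : nat).
Hypotheses (n0 : 0 < n) (r0 : 0 < r) (r3 : 3 <= r) (dn : 2 * d <= n).
Implicit Types (a : {ffun 'I_n -> bool}) (z : Z).

Definition nbr a z (s : bool + 'I_d) : qvert n r :=
  match s with
  | inl true => (a, lev r0 (z + 1))
  | inl false => (a, lev r0 (z - 1))
  | inr i => (flip a (cidx n d i (lev r0 z)), lev r0 z)
  end.

Lemma lev_neq z z' : (0 < z - z' < 3)%Z -> lev r0 z <> lev r0 z'.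
Proof.
move=> h /eqP/lev_eqP; rewrite Z.mod_small; try lia; split; try lia; move: r3 => /leP; lia.
Qed.

(** [r >= 3] keeps the levels [z - 1], [z], [z + 1] apart, and [d <= n] the [d] flips; sums over
    neighbours thus become sums over labels. *)
Lemma nbr_inj a z : injective (nbr a z).
Proof.
move=> [[]|i] [[]|j] //= e; have := congr1 fst e; have := congr1 snd e => /= e2 e1.
- by case: (@lev_neq (z + 1) (z - 1)) => //; lia.
- by case: (@lev_neq (z + 1) z) => //; lia.
- by case: (@lev_neq (z + 1) (z - 1)) => //; lia.
- by case: (@lev_neq z (z - 1)) => //; lia.
- by case: (@lev_neq (z + 1) z) => //; lia.
- by case: (@lev_neq z (z - 1)) => //; lia.
by move/flip_inj: e1 => /(_ (cidx_lt _ _ _ n0)) /cidx_inj -> //; lia.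
Qed.

Lemma lev_succ z y : (val y == (val (lev r0 z)).+1 %% r) = (y == lev r0 (z + 1)).
Proof.
have e : (val (lev r0 z)).+1 %% r = val (lev r0 (z + 1)).
  apply: Nat2Z.inj; rewrite modn_Z // -[RHS]/(Z.of_nat (lev r0 (z + 1))) levZ.
  by rewrite Nat2Z.inj_succ -/(Z.of_nat (lev r0 z)) [Z.of_nat _]levZ -Z.add_1_r Zplus_mod_idemp_l.
by rewrite e.
Qed.

Lemma lev_pred z y : (val (lev r0 z) == (val y).+1 %% r) = (y == lev r0 (z - 1)).
Proof.
have hy : y = lev r0 (Z.of_nat y).
  by have := ltn_ord y => ly; apply: val_inj; apply: Nat2Z.inj; rewrite [RHS]lev_nonneg //; lia.
rewrite {1}hy lev_succ {2}hy.
by apply/lev_eqP/lev_eqP => h; move/Z_mod_zero_opp_full: h => h; rewrite -h; congr (_ mod _)%Z; lia.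
Qed.

Lemma qadj_nbr a z w : qadj n d r (a, lev r0 z) w = (w \in nbr a z @: [set: bool + 'I_d]).
Proof.
case: w => b y; rewrite /qadj lev_succ lev_pred; apply/idP/imsetP.
  case/orP=> [/andP [/eqP <- /orP [] /eqP ->]|/andP [/eqP <- /existsP [i /eqP ->]]].
  - by exists (inl false).
  - by exists (inl true).
  by exists (inr i).
case=> [[[]|i] _] /= [-> ->]; rewrite ?eqxx ?orbT //=.
by apply/orP; right; apply/existsP; exists i.
Qed.

Lemma nwalksS k a z v :
  nwalks (qadj n d r) k.+1 (a, lev r0 z) v =
  nwalks (qadj n d r) k (a, lev r0 (z + 1)) v + nwalks (qadj n d r) k (a, lev r0 (z + -1)) v
  + \sum_(i < d) nwalks (qadj n d r) k (flip a (cidx n d i (lev r0 z)), lev r0 z) v.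
Proof.
rewrite /= (eq_bigl _ _ (qadj_nbr a z)) big_imset /=; last by move=> ? ? _ _; apply: nbr_inj.
rewrite (eq_bigl xpredT) => [|s]; last by rewrite in_setT.
by rewrite big_sumType big_bool.
Qed.
End Neighbours.

(** * Walk counts as sums over step shapes *)

Fixpoint zsum (w : seq Z) : Z := if w is s :: w' then (s + zsum w')%Z else 0%Z.

Lemma zsum_cons s w : zsum (s :: w) = (s + zsum w)%Z.
Proof. by []. Qed.

(* Step shapes of walks: the letters 1 and -1 move between levels, 0 is a flip at the current level
   whose direction is left open. *)
Fixpoint words k : seq (seq Z) :=
  if k is k'.+1 then
    [seq 1%Z :: w | w <- words k'] ++ [seq (-1)%Z :: w | w <- words k'] ++ [seq 0%Z :: w | w <- words k']
  else [:: [::]].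

Fixpoint stays (z : Z) (w : seq Z) : seq Z :=
  if w is s :: w' then
    if (s =? 0)%Z then z :: stays z w' else stays (z + s) w'
  else [::].

Definition zero_vec n : {ffun 'I_n -> bool} := [ffun=> false].

(* The number of ways to choose directions for the flips made at the levels [zs] so that they
   take [a] to the zero vector, [kappa z i] being the coordinate flipped by direction [i] at level [z]. *)
Fixpoint zways n d (kappa : Z -> nat -> nat) (zs : seq Z) (a : {ffun 'I_n -> bool}) : nat :=
  if zs is z :: zs' then \sum_(i < d) zways d kappa zs' (flip a (kappa z i))
  else a == zero_vec n.

(** Levels are measured relative to [x], so the same words index the sum for every base level and
    two base levels can be compared term by term. *)
Lemma nwalks_words n d r (r0 : 0 < r) k x z a : 0 < n -> 3 <= r -> 2 * d <= n ->
  nwalks (qadj n d r) k (a, lev r0 (x + z)) (zero_vec n, lev r0 x) =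
  \sum_(w <- words k | ((z + zsum w) mod Z.of_nat r =? 0)%Z)
    zways d (fun y i => cidx n d i (lev r0 (x + y))) (stays z w) a.
Proof.
move=> n0 r3 dn; elim: k z a => [|k IH] z a.
  rewrite /= big_mkcond big_seq1 /= xpair_eqE andbC Z.add_0_r.
  suff -> : (lev r0 (x + z) == lev r0 x) = (z mod Z.of_nat r =? 0)%Z by case: Z.eqb.
  apply/lev_eqP/Z.eqb_spec; by rewrite Z.add_simpl_l.
rewrite nwalksS //= !big_cat /= !big_map -!Z.add_assoc !IH addnA.
congr (_ + _ + _).
- by apply: eq_bigl => w; rewrite zsum_cons Z.add_assoc.
- by apply: eq_bigl => w; rewrite zsum_cons Z.add_assoc.
rewrite /= exchange_big /=.
by apply: eq_bigr => i _; rewrite IH.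
Qed.

Lemma words_spec k w : w \in words k -> size w = k /\ all (fun s => (-1 <=? s)%Z && (s <=? 1)%Z) w.
Proof.
elim: k w => [|k IH] w /=; first by rewrite inE => /eqP ->.
by rewrite !mem_cat => /or3P [] /mapP [w' /IH [<- h] ->] /=.
Qed.

(** [W] is the number of level moves of [w]. Each bound is the triangle inequality for a path on the
    integer line from [z] to [e] through the levels where it flips, a pair being met in one of two
    orders. *)
Lemma stays_bounds z w W e : all (fun s => (-1 <=? s)%Z && (s <=? 1)%Z) w ->
  Z.of_nat (size w) = (W + Z.of_nat (size (stays z w)))%Z -> e = (z + zsum w)%Z ->
  [/\ (Z.abs (e - z) <= W)%Z,
      forall y, y \in stays z w -> (Z.abs (y - z) + Z.abs (e - y) <= W)%Z &
      forall y y', y \in stays z w -> y' \in stays z w ->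
        (Z.abs (y - z) + Z.abs (y' - y) + Z.abs (e - y') <= W)%Z \/
        (Z.abs (y' - z) + Z.abs (y - y') + Z.abs (e - y) <= W)%Z].
Proof.
elim: w z W => [|s w IH] z W; first by move=> _ /= h1 h2; split=> //; lia.
case/andP=> /andP [/Z.leb_spec0 s1 /Z.leb_spec0 s2] hw.
rewrite zsum_cons [stays z _]/= -[size (s :: w)]/((size w).+1).
case: Z.eqb_spec => [->|s0].
  rewrite -[size (z :: _)]/((size (stays z w)).+1) => eW ee.
  have [h1 h2 h3] := IH z W hw ltac:(lia) ltac:(lia); split; first lia.
    by move=> y; rewrite inE => /orP [/eqP ->|/h2]; lia.
  move=> y y'; rewrite !inE => /orP [/eqP ->|hy] /orP [/eqP ->|hy'].
  - by left; lia.
  - by have := h2 _ hy'; left; lia.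
  - by have := h2 _ hy; right; lia.
  by have := h3 _ _ hy hy'; lia.
move=> eW ee; have [h1 h2 h3] := IH (z + s)%Z (W - 1)%Z hw ltac:(lia) ltac:(lia); split; first lia.
  by move=> y /h2; lia.
by move=> y y' hy hy'; have [h|h] := h3 _ _ hy hy'; [left|right]; lia.
Qed.

(** * Invariance of flip counts under relabelling of coordinates *)

Section Relabelling.
Variables (n d : nat) (L : seq Z).
Implicit Types (z : Z) (k : Z -> nat -> nat) (a : {ffun 'I_n -> bool}).

(** One half of an invariant that is used in both directions: together the halves make [a] and [a']
    correspond on labelled coordinates and vanish elsewhere, so they become zero together. *)
Definition same_trace (k k' : Z -> nat -> nat) (a a' : {ffun 'I_n -> bool}) :=
  (forall z (i : 'I_d) (c1 c2 : 'I_n), z \in L ->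
     val c1 = k z i -> val c2 = k' z i -> a c1 = a' c2) /\
  (forall c, a c -> exists z (i : 'I_d), z \in L /\ val c = k z i).

Lemma same_trace_zero k k' a a' : (forall z i, k z i < n) ->
  same_trace k k' a a' -> same_trace k' k a' a -> a = zero_vec n -> a' = zero_vec n.
Proof.
move=> l1 [h1 _] [_ h2] e; apply/ffunP=> c; rewrite ffunE; apply/negbTE/negP => ac.
have [z [i [zL ci]]] := h2 _ ac.
by have := h1 z i (Ordinal (l1 z i)) c zL erefl ci; rewrite e ffunE ac.
Qed.

Lemma same_trace_flip k k' a a' z (i : 'I_d) :
  (forall z z' (i j : 'I_d), z \in L -> z' \in L -> (k z i == k z' j) = (k' z i == k' z' j)) ->
  z \in L -> same_trace k k' a a' -> same_trace k k' (flip a (k z i)) (flip a' (k' z i)).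
Proof.
move=> pat zL [h1 h2]; split=> [z' j c1 c2 zL' e1 e2 | c].
  by rewrite !ffunE (h1 _ _ _ _ zL' e1 e2) e1 e2 pat.
rewrite ffunE; case: eqP => [e _|_]; first by exists z, i.
by case E: (a c) => // _; apply: h2.
Qed.

(* [zways] depends only on which of the coordinates met along the way coincide. *)
Lemma eq_zways k k' zs a a' :
  (forall z i, k z i < n) -> (forall z i, k' z i < n) ->
  (forall z z' (i j : 'I_d), z \in L -> z' \in L -> (k z i == k z' j) = (k' z i == k' z' j)) ->
  {subset zs <= L} -> same_trace k k' a a' -> same_trace k' k a' a ->
  zways d k zs a = zways d k' zs a'.
Proof.
move=> l1 l2 pat; elim: zs a a' => [|z zs IH] a a' sub t12 t21 /=.
  suff -> : (a == zero_vec n) = (a' == zero_vec n) by [].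
  by apply/eqP/eqP; [apply: (same_trace_zero l1 t12 t21) | apply: (same_trace_zero l2 t21 t12)].
have zL : z \in L by apply: sub; rewrite inE eqxx.
apply: eq_bigr => i _; apply: IH.
- by move=> y hy; apply: sub; rewrite inE hy orbT.
- exact: same_trace_flip.
by apply: same_trace_flip => // y y' p q *; rewrite pat.
Qed.

End Relabelling.

Lemma same_trace0 n d L k k' : same_trace d L k k' (zero_vec n) (zero_vec n).
Proof. by split=> [*|c]; rewrite !ffunE. Qed.

Lemma zways2 n d (kappa : Z -> nat -> nat) z z' : (forall z i, kappa z i < n) ->
  zways d kappa [:: z; z'] (zero_vec n) =
  #|[set p : 'I_d * 'I_d | kappa z p.1 == kappa z' p.2]|.
Proof.
move=> l1; rewrite /= pair_big /= -sum1dep_card [RHS]big_mkcond /=.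
apply: eq_bigr => -[i j] _ /=.
suff -> : (flip (flip (zero_vec n) (kappa z i)) (kappa z' j) == zero_vec n) = (kappa z i == kappa z' j)
  by case: (_ == _).
apply/eqP/eqP => [e | ->]; last by rewrite flipK.
by apply: (@flip_inj _ (zero_vec n)) => //; rewrite -[LHS](flipK _ (kappa z' j)) e.
Qed.

Lemma ltn_sum_seq (T : eqType) (s : seq T) (P : pred T) (F G : T -> nat) w :
  w \in s -> P w -> F w < G w -> (forall v, v \in s -> P v -> F v <= G v) ->
  \sum_(v <- s | P v) F v < \sum_(v <- s | P v) G v.
Proof.
move=> ws Pw Fw FG; rewrite !(big_rem w ws) /= Pw -addSn leq_add //.
rewrite big_seq_cond [leqRHS]big_seq_cond leq_sum // => v /andP [/mem_rem vs Pv].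
exact: FG.
Qed.

Lemma mem_words k w : size w = k -> all (fun s => s \in [:: 1; -1; 0]%Z) w -> w \in words k.
Proof.
elim: w k => [|s w IH] [|k] //= [sw] /andP [hs hw]; rewrite !mem_cat.
have wk := IH _ sw hw.
by move: hs; rewrite !inE => /or3P [] /eqP ->; apply/or3P; [apply: Or31|apply: Or32|apply: Or33]; apply: map_f.
Qed.

Lemma stays_nseq z u v w : v <> 0%Z -> stays z (nseq u v ++ w) = stays (z + Z.of_nat u * v) w.
Proof.
move=> v0; elim: u z => [|u IH] z; first by congr stays; lia.
have -> : (z + Z.of_nat u.+1 * v = z + v + Z.of_nat u * v)%Z by rewrite Nat2Z.inj_succ; lia.
by rewrite /= (introF (Z.eqb_spec _ _) v0) IH.
Qed.

Lemma zsum_nseq u v w : zsum (nseq u v ++ w) = (Z.of_nat u * v + zsum w)%Z.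
Proof. elim: u => [|u IH] //; rewrite -[nseq u.+1 v ++ w]/(v :: (nseq u v ++ w)) zsum_cons IH.
rewrite Nat2Z.inj_succ; lia. Qed.

(** * The seam between levels r - 1 and 0 *)

Section Seam.
(* [t = max 1 (s %/ d)] is the least distance at which flip sets overlap across the seam. *)
Variables (n d r q s t : nat).
Hypotheses (r0 : 0 < r) (d0 : 0 < d) (dn : 2 * d <= n) (rE : d * r = q * n + s)
  (s0 : 0 < s) (sn : s < n) (t0 : 0 < t) (tr : 2 * t < r)
  (tE : d * t <= s /\ s < d * t + d \/ t = 1 /\ s < d).
Implicit Types (y : Z) (i j : 'I_d).

Let nZ : (0 < Z.of_nat n)%Z. Proof. lia. Qed.
Let n0 : 0 < n. Proof. lia. Qed.

(* Levels relative to the start: [mid_coord] for walks starting at level [t], which stay within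
   0..2t < r, and [seam_coord] for walks starting at level 0, which can cross from 0 to r - 1. *)
Definition mid_coord y (i : nat) := cidx n d i (lev r0 (Z.of_nat t + y)).
Definition seam_coord y (i : nat) := cidx n d i (lev r0 (0 + y)).

Lemma mid_coord_lt y (i : nat) : mid_coord y i < n. Proof. exact: cidx_lt. Qed.
Lemma seam_coord_lt y (i : nat) : seam_coord y i < n. Proof. exact: cidx_lt. Qed.

Lemma mid_coordP y y' i j : (Z.abs y <= Z.of_nat t)%Z -> (Z.abs y' <= Z.of_nat t)%Z ->
  mid_coord y i = mid_coord y' j <->
  exists m, (Z.of_nat i - Z.of_nat j + Z.of_nat d * (y' - y) = m * Z.of_nat n)%Z.
Proof.
move=> hy hy'; rewrite /mid_coord (cidx_eqP _ _ _ _ _ n0) !lev_nonneg; try lia.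
by split=> -[m hm]; exists m; lia.
Qed.

(** Level [y < 0] stands for [y + r], and [d * r] is congruent to [s] modulo [n]: crossing the seam
    moves the flip set down by [s]. *)
Definition wrap y : Z := if (y <? 0)%Z then Z.of_nat s else 0%Z.

Lemma seam_coordP y y' i j : (Z.abs y <= Z.of_nat t)%Z -> (Z.abs y' <= Z.of_nat t)%Z ->
  seam_coord y i = seam_coord y' j <->
  exists m, (Z.of_nat i - Z.of_nat j + Z.of_nat d * (y' - y) - wrap y + wrap y' = m * Z.of_nat n)%Z.
Proof.
move=> hy hy'; rewrite /seam_coord (cidx_eqP _ _ _ _ _ n0) /wrap !Z.add_0_l.
have E : (Z.of_nat d * Z.of_nat r = Z.of_nat q * Z.of_nat n + Z.of_nat s)%Z by lia.
have levE x : (Z.abs x <= Z.of_nat t)%Z ->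
    Z.of_nat (lev r0 x) = (x + (if (x <? 0)%Z then Z.of_nat r else 0))%Z.
  by move=> hx; case: Z.ltb_spec0 => h; [rewrite lev_neg | rewrite lev_nonneg]; lia.
rewrite !levE //; case: Z.ltb_spec0 => h; case: Z.ltb_spec0 => h'.
- by split=> -[m hm]; exists m; lia.
- by split=> -[m hm]; [exists (m + Z.of_nat q)%Z | exists (m - Z.of_nat q)%Z]; lia.
- by split=> -[m hm]; [exists (m - Z.of_nat q)%Z | exists (m + Z.of_nat q)%Z]; lia.
by split=> -[m hm]; exists m; lia.
Qed.

Lemma mult_cases m (N : Z) : (0 < N)%Z -> 
  [\/ m = 0%Z, m = 1%Z /\ (m * N = N)%Z, (m * N >= 2 * N)%Z | (m * N <= - N)%Z].
Proof.
move=> h; have [->|[->|[h1|h1]]] : (m = 0 \/ m = 1 \/ m >= 2 \/ m <= -1)%Z by lia.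
- exact: Or41.
- by apply: Or42; lia.
- by apply: Or43; nia.
by apply: Or44; nia.
Qed.

(** [i - j + d * (y' - y)] lies strictly between 0 and [n]; for [t = 1] the range of [y' - y] is
    empty. *)
Lemma mid_coord_near y y' i j : (Z.abs y <= Z.of_nat t)%Z -> (Z.abs y' <= Z.of_nat t)%Z ->
  (0 < y' - y < Z.of_nat t)%Z -> mid_coord y i = mid_coord y' j -> False.
Proof.
move=> hy hy' u /(mid_coordP _ _ hy hy') [m hm].
have := ltn_ord i; have := ltn_ord j => lj li.
have u1 : (Z.of_nat d * (y' - y) >= Z.of_nat d)%Z by nia.
have u2 : (Z.of_nat d * (y' - y) <= Z.of_nat d * Z.of_nat t - Z.of_nat d)%Z by nia.
by case: tE => tE'; have [hh|[_ hh]|hh|hh] := mult_cases m nZ; try (rewrite hh in hm); lia.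
Qed.

(** Across the seam [s] is subtracted, and [d * t <= s] then puts the difference strictly between
    [-n] and 0. *)
Lemma seam_coord_near y y' i j : (Z.abs y <= Z.of_nat t)%Z -> (Z.abs y' <= Z.of_nat t)%Z ->
  (0 < y' - y < Z.of_nat t)%Z -> seam_coord y i = seam_coord y' j -> False.
Proof.
move=> hy hy' u /(seam_coordP _ _ hy hy') [m hm].
have := ltn_ord i; have := ltn_ord j => lj li.
have u1 : (Z.of_nat d * (y' - y) >= Z.of_nat d)%Z by nia.
have u2 : (Z.of_nat d * (y' - y) <= Z.of_nat d * Z.of_nat t - Z.of_nat d)%Z by nia.
move: hm; rewrite /wrap; case: Z.ltb_spec0 => h; case: Z.ltb_spec0 => h' hm;
 by case: tE => tE'; have [hh|[_ hh]|hh|hh] := mult_cases m nZ; try (rewrite hh in hm); lia.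
Qed.

Lemma pattern_near y y' i j :
  y = y' \/ [/\ (Z.abs y <= Z.of_nat t)%Z, (Z.abs y' <= Z.of_nat t)%Z & (Z.abs (y - y') < Z.of_nat t)%Z] ->
  (mid_coord y i == mid_coord y' j) = (seam_coord y i == seam_coord y' j).
Proof.
move=> h; have [<-|ne] := Z.eq_dec y y'.
  have dn' : d <= n by lia.
  by rewrite /mid_coord /seam_coord !(eqtype.inj_eq (@cidx_inj n d _ n0 dn')).
case: h => [//|[hy hy' hh]].
have [lt|lt] : (0 < y' - y < Z.of_nat t)%Z \/ (0 < y - y' < Z.of_nat t)%Z by lia.
  by apply/eqP/eqP => [/mid_coord_near|/seam_coord_near]; case.
by apply/eqP/eqP => /esym => [/mid_coord_near|/seam_coord_near]; case.
Qed.

Definition meets (kappa : Z -> nat -> nat) y y' : {set 'I_d * 'I_d} :=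
  [set p : 'I_d * 'I_d | kappa y p.1 == kappa y' p.2].

Lemma meetsC kappa y y' : #|meets kappa y y'| = #|meets kappa y' y|.
Proof.
have swapK : involutive (fun p : 'I_d * 'I_d => (p.2, p.1)) by case.
rewrite -(card_imset _ (inv_inj swapK)); apply: eq_card => p.
by rewrite (can_imset_pre _ swapK) !inE eq_sym.
Qed.

(* Turns a coincidence of coordinates at distance [t] away from the seam into one across it. *)
Definition shift_hi (p : 'I_d * 'I_d) := (p.1, insubd p.2 (p.2 + (n - s))).

(** [i - j + d * t] is positive and below [2 * n], so a coincidence makes it equal [n]. Then
    [j + (n - s) = i + d * t - s <= i < d], so the default of [insubd] is not taken. *)
Lemma meets_seam y p : (- Z.of_nat t <= y < 0)%Z ->
  p \in meets mid_coord y (y + Z.of_nat t) ->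
  [/\ val (shift_hi p).2 = p.2 + (n - s) & shift_hi p \in meets seam_coord y (y + Z.of_nat t)].
Proof.
case: p => i j hy; rewrite !inE /= => /eqP /mid_coordP h.
have := ltn_ord i; have := ltn_ord j => lj li.
have [m] := h ltac:(lia) ltac:(lia); rewrite Z.add_simpl_l => hm.
have u1 : (Z.of_nat d * Z.of_nat t >= Z.of_nat d)%Z by nia.
have [hd hj] : d * t <= s /\ (Z.of_nat i - Z.of_nat j + Z.of_nat d * Z.of_nat t = Z.of_nat n)%Z.
  by case: tE => tE'; have [hh|[_ hh]|hh|hh] := mult_cases m nZ; try (rewrite hh in hm); lia.
have hv : val (insubd j (j + (n - s))) = j + (n - s).
  by rewrite val_insubd; case: ifP => //; lia.
split=> //; apply/eqP/seam_coordP; try lia; exists 0%Z; rewrite hv Z.add_simpl_l /wrap.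
by case: Z.ltb_spec0; case: Z.ltb_spec0; lia.
Qed.

Lemma shift_hi_inj y : (- Z.of_nat t <= y < 0)%Z ->
  {in meets mid_coord y (y + Z.of_nat t) &, injective shift_hi}.
Proof.
move=> hy [i j] [i' j'] h h' e; have [e1 _] := meets_seam hy h; have [e2 _] := meets_seam hy h'.
have := congr1 fst e; rewrite /= => ->; congr (_, _); apply: val_inj.
by move: e1; rewrite e e2 /=; lia.
Qed.

(** The overlaps can differ only at distance [t] with the lower level negative; there [shift_hi]
    injects one into the other. *)
Lemma leq_meets y y' : (Z.abs y <= Z.of_nat t)%Z -> (Z.abs y' <= Z.of_nat t)%Z ->
  (Z.abs (y - y') <= Z.of_nat t)%Z -> #|meets mid_coord y y'| <= #|meets seam_coord y y'|.
Proof.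
wlog: y y' / (y <= y')%Z => [wl|].
  have [h|h] : (y <= y' \/ y' <= y)%Z by lia.
    exact: wl.
  by move=> *; rewrite !(meetsC _ y); apply: wl => //; lia.
move=> le hy hy' hu.
have [near|far] : (y' - y < Z.of_nat t \/ y' = y + Z.of_nat t)%Z by lia.
  by apply/eq_leq/eq_card => p; rewrite !inE pattern_near //; right; split; lia.
have [y0|y0] : (y = 0 \/ - Z.of_nat t <= y < 0)%Z by lia.
  apply/eq_leq/eq_card => p; rewrite !inE.
  by apply/eqP/eqP; rewrite (seam_coordP _ _ hy hy') (mid_coordP _ _ hy hy') => -[m hm]; exists m; move: hm; rewrite /wrap far y0;
    case: Z.ltb_spec0; case: Z.ltb_spec0; lia.
rewrite far -(card_in_imset (shift_hi_inj y0)); apply/subset_leq_card/subsetP => _ /imsetP [p hp ->].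
by have [] := meets_seam y0 hp.
Qed.

(** [shift_hi] yields only pairs with second component at least [n - s]. The pair [(s - d * t, 0)],
    or [(0, d - s)] when [t = 1] and [s < d], is a coincidence across the seam that it misses. *)
Lemma ltn_meets : #|meets mid_coord (- Z.of_nat t) 0| < #|meets seam_coord (- Z.of_nat t) 0|.
Proof.
have hy : (- Z.of_nat t <= - Z.of_nat t < 0)%Z by lia.
have := @shift_hi_inj _ hy; have := fun p => @meets_seam _ p hy; rewrite Z.add_opp_diag_l => hs hi.
rewrite -(card_in_imset hi); apply/proper_card/properP; split.
  by apply/subsetP => _ /imsetP [p hp ->]; have [] := hs _ hp.
have bad (i j : 'I_d) : (Z.of_nat i - Z.of_nat j + Z.of_nat d * Z.of_nat t - Z.of_nat s = 0)%Z ->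
    (i, j) \in meets seam_coord (- Z.of_nat t) 0.
  move=> e; rewrite inE; apply/eqP/seam_coordP; try lia; exists 0%Z; rewrite /wrap /=.
  by case: Z.ltb_spec0; lia.
case: tE => [[h1 h2]|[h1 h2]].
  have hi0 : s - d * t < d by lia.
  exists (Ordinal hi0, Ordinal d0); first by apply: bad => /=; lia.
  apply/imsetP => -[p /hs [hp _] e]; move: hp; rewrite -e /=; lia.
have hj : d - s < d by lia.
exists (Ordinal d0, Ordinal hj); first by apply: bad; rewrite /= h1; lia.
apply/imsetP => -[p /hs [hp _] e]; move: hp (congr1 fst e); rewrite -e /= => hp.
by have := ltn_ord p.2; lia.
Qed.

Lemma meets_zways (kappa : Z -> nat -> nat) y y' : (forall y (i : nat), kappa y i < n) ->
  zways d kappa [:: y; y'] (zero_vec n) = #|meets kappa y y'|.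
Proof. exact: zways2. Qed.

(* A closed word of length 2t+2 with at least three flips never reaches two levels t apart, so it is
   blind to the seam; with exactly two flips the number of lifts is an overlap of flip sets. *)
Lemma leq_zways w : w \in words (2 * t).+2 -> (zsum w mod Z.of_nat r = 0)%Z ->
  zways d mid_coord (stays 0 w) (zero_vec n) <= zways d seam_coord (stays 0 w) (zero_vec n).
Proof.
move=> /words_spec [sw hw] /Z.mod_divide [|m hm]; first lia.
have [W hW] : exists W, Z.of_nat (size w) = (W + Z.of_nat (size (stays 0 w)))%Z.
  by exists (Z.of_nat (size w) - Z.of_nat (size (stays 0 w)))%Z; lia.
have [b1 b2 b3] := stays_bounds hw hW erefl.
(* Two flips leave at most [2 * t < r] level moves, too few to wind around the ring. *)
have far : 1 < size (stays 0 w) -> zsum w = 0%Z.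
  move=> h; have : (Z.abs (m * Z.of_nat r) < Z.of_nat r)%Z by lia.
  move=> lt; have m0 : m = 0%Z by nia.
  by rewrite hm m0.
have same : size (stays 0 w) != 2 -> 
    zways d mid_coord (stays 0 w) (zero_vec n) = zways d seam_coord (stays 0 w) (zero_vec n).
  move=> h; apply: (@eq_zways n d (stays 0 w)) => //; try exact: same_trace0.
  - exact: mid_coord_lt.
  - exact: seam_coord_lt.
  move=> y y' i j hy hy'; apply: pattern_near.
  have [h1|h1] := leqP (size (stays 0 w)) 1.
    by left; move: h1 hy hy'; case: (stays 0 w) => [|z [|]] //=; rewrite !inE => _ /eqP -> /eqP ->.
  (* At least three flips leave at most [2 * t - 1] moves, while a closed tour through [y] and [y']
     takes at least twice their distance. *)
  right; move: (far h1) (b2 _ hy) (b2 _ hy') (b3 _ _ hy hy') => -> *; split; lia.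
have [h|/same -> //] := eqVneq (size (stays 0 w)) 2.
have z0 : zsum w = 0%Z by apply: far; rewrite h.
move: h b2 b3 => {same far}; rewrite {}z0.
case: (stays 0 w) hW => [|y [|y' [|]]] //= hW _ b2 b3.
have := b2 y; have := b2 y'; have := b3 y y'; rewrite !inE !eqxx ?orbT => /(_ erefl erefl) c1 /(_ erefl) c2 /(_ erefl) c3.
have W2 : (W = 2 * Z.of_nat t)%Z by rewrite sw in hW; clear -hW; lia.
clear - W2 c1 c2 c3 r0 d0 dn rE s0 sn t0 tr tE nZ n0.
by rewrite -/(zways d mid_coord [:: y; y'] _) -/(zways d seam_coord [:: y; y'] _)  !meets_zways;
  [apply: leq_meets; lia | exact: seam_coord_lt | exact: mid_coord_lt].
Qed.

Lemma ltn_walks : 3 <= r ->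
  nwalks (qadj n d r) (2 * t).+2 (zero_vec n, lev r0 (Z.of_nat t)) (zero_vec n, lev r0 (Z.of_nat t)) <
  nwalks (qadj n d r) (2 * t).+2 (zero_vec n, lev r0 0) (zero_vec n, lev r0 0).
Proof.
move=> r3; rewrite -{1}[Z.of_nat t]Z.add_0_r -{2}[0%Z](Z.add_0_r 0) !nwalks_words //.
(* Down [t] levels, flip, back up, flip: a shape whose overlap is strictly larger across the
   seam. *)
pose w0 := nseq t (-1)%Z ++ 0%Z :: nseq t 1%Z ++ [:: 0%Z].
have s0E : zsum w0 = 0%Z by rewrite /w0 zsum_nseq zsum_cons zsum_nseq /=; lia.
have stE : stays 0 w0 = [:: - Z.of_nat t; 0]%Z.
  rewrite /w0 stays_nseq // [stays _ (0%Z :: _)]/= stays_nseq //=; congr [:: _; _]; lia.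
apply: (@ltn_sum_seq _ _ _ _ _ w0).
- apply: mem_words; first by rewrite size_cat /= size_cat !size_nseq /=; lia.
  by rewrite all_cat /= all_cat !all_nseq /= !orbT.
- by rewrite s0E.
- by rewrite stE (meets_zways _ _ mid_coord_lt) (meets_zways _ _ seam_coord_lt); exact: ltn_meets.
by move=> w hw /Z.eqb_spec e; apply: leq_zways.
Qed.

End Seam.

(** * The Cayley structure when [n] divides [d * r] *)

Lemma cidx_mod n d i x k : k < n -> (k == cidx n d i x) = (k + d * x == i %[mod n]).
Proof.
move=> kn; have n0 : 0 < n by lia.
have cE : cidx n d i x + d * x = i %[mod n].
  by rewrite /cidx modnDml -modnDmr -addnA subnK ?modnDr // ltnW // ltn_mod.
by rewrite -cE eqn_modDr !modn_small // cidx_lt.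
Qed.

Lemma qadj_sym n d r : symmetric (qadj n d r).
Proof.
move=> [a x] [b y]; rewrite /qadj (eq_sym b) (eq_sym y); congr (_ && _ || _); first by rewrite orbC.
have [->|//] := eqVneq x y.
by apply/existsP/existsP => -[i /eqP ->]; exists i; rewrite flipK.
Qed.

Lemma qadj_irr n d r : 0 < n -> 3 <= r -> irreflexive (qadj n d r).
Proof.
move=> n0 r3 [a x]; rewrite /qadj !eqxx orbb /=; apply/negbTE/negP => /orP [/eqP e|/existsP [i /eqP]].
  have lx := ltn_ord x; have [lt|ge] := ltnP x.+1 r; first by rewrite modn_small // in e; lia.
  have xr : x.+1 = r by lia.
  by rewrite /= xr modnn in e; lia.
by move/esym/flip_neq; apply; apply: cidx_lt.
Qed.

(* The semidirect product of Z_2^n by Z_r, where 1 acts as the shift of coordinates by [d];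
   this action of Z_r is well defined because n divides d r. *)
Section CubeGroup.
Variables (n d r : nat) (n0 : 0 < n) (r0 : 0 < r) (nD : n %| d * r).

Definition rot_ord (m : nat) (k : 'I_n) : 'I_n := Ordinal (ltn_pmod (k + m) n0).
Definition mod_ord (m : nat) : 'I_r := Ordinal (ltn_pmod m r0).

(** Here [nD] makes the shift by [d] an action of Z_r: reducing a level modulo [r] does not change
    its shift. *)
Lemma modn_muld m : d * (m %% r) = d * m %[mod n].
Proof.
rewrite [in RHS](divn_eq m r) mulnDr mulnCA -[RHS]modnDml.
by rewrite (eqP (dvdn_mull (m %/ r) nD)).
Qed.

Lemma rot_ordD m p k : rot_ord m (rot_ord p k) = rot_ord (p + m) k.
Proof. by apply: val_inj; rewrite /= modnDml addnA. Qed.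

Lemma eq_rot_ord m p k : m = p %[mod n] -> rot_ord m k = rot_ord p k.
Proof. by move=> e; apply: val_inj; rewrite /= -modnDmr e modnDmr. Qed.

Lemma rot_ord0 k : rot_ord 0 k = k.
Proof. by apply: val_inj; rewrite /= addn0 modn_small. Qed.

(** Reading [v.1] at [k + d * x], with [x] the level of [u], turns [e_i] into [e_(i - d x)], so
    right multiplication by [e_i] is a flip of the graph at level [x]. *)
Definition cube_mul (u v : qvert n r) : qvert n r :=
  ([ffun k => u.1 k (+) v.1 (rot_ord (d * u.2) k)], mod_ord (u.2 + v.2)).
Definition cube_one : qvert n r := (zero_vec n, mod_ord 0).
Definition cube_inv (u : qvert n r) : qvert n r :=
  ([ffun k => u.1 (rot_ord (d * (r - u.2)) k)], mod_ord (r - u.2)).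

Lemma cube_mulA : associative cube_mul.
Proof.
move=> [a x] [b y] [c z]; congr (_, _) => /=; last first.
  by apply: val_inj; rewrite /= modnDml modnDmr addnA.
apply/ffunP=> k; rewrite !ffunE /= rot_ordD -addbA; congr (_ (+) (_ (+) c _)).
by apply: eq_rot_ord; rewrite modn_muld mulnDr.
Qed.

Lemma cube_mul1g : left_id cube_one cube_mul.
Proof.
move=> [a x]; congr (_, _); last by apply: val_inj; rewrite /= mod0n add0n modn_small.
by apply/ffunP=> k; rewrite !ffunE /= mod0n muln0 rot_ord0.
Qed.

Lemma cube_mulg1 : right_id cube_one cube_mul.
Proof.
move=> [a x]; congr (_, _); last by apply: val_inj; rewrite /= mod0n addn0 modn_small.
by apply/ffunP=> k; rewrite !ffunE /= addbF.
Qed.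

Lemma rot_ord_dr k : rot_ord (d * r) k = k.
Proof. by rewrite (@eq_rot_ord _ 0) ?rot_ord0 // (eqP nD) mod0n. Qed.

Lemma cube_mulVg : left_inverse cube_one cube_inv cube_mul.
Proof.
move=> [a x]; congr (_, _) => /=; last first.
  by apply: val_inj; rewrite /= modnDml subnK ?modnn ?mod0n // ltnW.
apply/ffunP=> k; rewrite !ffunE /=; rewrite (eq_rot_ord (p := d * (r - x))) ?addbb //.
exact: modn_muld.
Qed.

Lemma cube_mulgV : right_inverse cube_one cube_inv cube_mul.
Proof.
move=> [a x]; have lx : x <= r by apply: ltnW.
congr (_, _) => /=; last by apply: val_inj; rewrite /= modnDmr subnKC ?modnn ?mod0n.
apply/ffunP=> k; rewrite !ffunE /= rot_ordD -mulnDr subnKC // rot_ord_dr addbb //.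
Qed.

Lemma cube_mul_qadj g u v : qadj n d r u v -> qadj n d r (cube_mul g u) (cube_mul g v).
Proof.
case: g u v => c z [a x] [b y] /orP [/andP [/eqP <- h]|/andP [/eqP <- /existsP [i /eqP ->]]].
  rewrite /qadj /cube_mul eqxx /=; apply/orP; left.
  have hS m : (m %% r).+1 %% r = m.+1 %% r by rewrite -addn1 modnDml addn1.
  by case/orP: h => /eqP ->; apply/orP; [left|right]; apply/eqP; rewrite ?modnDmr /= hS ?addnS.
rewrite /qadj /cube_mul eqxx /=; apply/orP; right; apply/existsP; exists i; apply/eqP/ffunP => k.
have xorbE p q : xorb p q = p (+) q by case: p; case: q.
rewrite !ffunE /= !xorbE -addbA; congr (_ (+) (_ (+) _)).
rewrite [LHS]cidx_mod ?ltn_mod // [RHS]cidx_mod //; congr (_ == _).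
by rewrite modnDml -addnA -mulnDr -[RHS]modnDmr modn_muld modnDmr.
Qed.

(** The [let]s make the hypotheses parameters of the type, from which the group instance recovers
    them. *)
Definition cube_group : Type := let _ := nD in let _ := n0 in let _ := r0 in qvert n r.
HB.instance Definition _ := Finite.copy cube_group (qvert n r).
HB.instance Definition _ := isGroup.Build cube_group
  cube_mulA cube_mul1g cube_mulg1 cube_mulVg cube_mulgV.

Lemma cayley_qadj : 3 <= r -> is_cayley_graph (qadj n d r).
Proof.
move=> r3; pose e : rel cube_group := qadj n d r.
have mul_e (g u v : cube_group) : e u v -> e (g * u)%g (g * v)%g by apply: cube_mul_qadj.
have e_mul (g u v : cube_group) : e (g * u)%g (g * v)%g = e u v.
  by apply/idP/idP => [/(mul_e g^-1%g)|/mul_e]; rewrite ?mulKg.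
exists (cube_group : finGroupType), [set s | e 1%g s]; split.
- by rewrite inE /e qadj_irr.
- by move=> s; rewrite !inE => h; rewrite -(e_mul s) mulg1 mulgV /e qadj_sym.
exists id; split; first by exists id.
by move=> u v; rewrite inE -(e_mul u) mulg1 mulKVg.
Qed.

End CubeGroup.

(** * Connectedness *)

Lemma cidx_surj n d r j : n <= d * r -> j < n ->
  exists (x : 'I_r) (i : 'I_d), cidx n d i x = j.
Proof.
move=> ndr jn; have n0 : 0 < n by lia.
have d0 : 0 < d by lia.
(* Over all levels and directions, [i - d * x] runs down from [d - 1] through [d * r] consecutive
   integers; [v] is the depth at which [j] is met, and division by [d] splits it into level and
   direction. *)
pose v := (d - 1 + (n - j)) %% n.
have vn : v < n by rewrite ltn_mod.
have xr : v %/ d < r by rewrite ltn_divLR // mulnC; lia.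
have lt := ltn_pmod v d0; have ih : d - 1 - v %% d < d by lia.
exists (Ordinal xr), (Ordinal ih); apply/esym/eqP; rewrite cidx_mod //=.
have -> : d - 1 - v %% d = d - 1 + d * (v %/ d) - v.
  by have := divn_eq v d; rewrite [_ %/ _ * _]mulnC; lia.
have vq := divn_eq (d - 1 + (n - j)) n; rewrite -/v in vq.
have vd := divn_eq v d; rewrite [_ %/ _ * _]mulnC in vd.
rewrite -(eqn_modDr v) subnK; last lia.
rewrite -[X in X == _](modnMDl ((d - 1 + (n - j)) %/ n)) -[X in _ == X]modnDr.
by apply/eqP; congr (_ %% _); lia.
Qed.

(** At most [d * r] coordinates are ever flipped, and a coordinate in no flip set is constant along
    edges. *)
Lemma connected_dim n d r : 0 < r -> connected_graph (qadj n d r) -> n <= d * r.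
Proof.
move=> r0 conn; rewrite leqNgt; apply/negP => lt.
have n0 : 0 < n by lia.
pose D := [set Ordinal (cidx_lt d p.1 p.2 n0) | p : 'I_d * 'I_r].
have [j jD] : exists j, j \notin D.
  apply/existsP; rewrite -negb_forall; apply/negP => /forallP allD.
  have : #|D| = n by rewrite -[RHS]card_ord; apply: eq_card => j; rewrite allD.
  by have := leq_imset_card (fun p : 'I_d * 'I_r => Ordinal (cidx_lt d p.1 p.2 n0)) predT;
    rewrite card_prod !card_ord -/D; lia.
have cl : closed (qadj n d r) [pred v : qvert n r | v.1 j].
  move=> [a x] [b y] /orP [/andP [/eqP <- _]|/andP [_ /existsP [i /eqP ->]]] //.
  rewrite !inE /= ffunE; case: eqP => [e|_]; last by case: (a j).
  case/negP: jD; apply/imsetP; exists (i, x) => //; exact: val_inj.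
have := closed_connect cl (conn (zero_vec n, Ordinal r0) (flip (zero_vec n) j, Ordinal r0)).
by rewrite !inE /= !ffunE eqxx.
Qed.

(** To flip coordinate [j], go round the ring to a level that flips it, flip, and return; differing
    coordinates are removed one by one. *)
Lemma connected_qadj n d r : 0 < r -> n <= d * r -> connected_graph (qadj n d r).
Proof.
move=> r0 ndr; have csym := sym_connect_sym (@qadj_sym n d r).
have level a (x y : 'I_r) : connect (qadj n d r) (a, x) (a, y).
  have from0 (m : nat) : connect (qadj n d r) (a, lev r0 0) (a, lev r0 (Z.of_nat m)).
    elim: m => [|m IH]; first exact: connect0.
    apply: (connect_trans IH); apply/connect1/orP; left; rewrite eqxx.
    by apply/orP; right; rewrite lev_succ Nat2Z.inj_succ.
  have ordE (z : 'I_r) : z = lev r0 (Z.of_nat z).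
    have lz := ltn_ord z; apply: val_inj; apply: Nat2Z.inj.
    by rewrite [RHS]lev_nonneg //; lia.
  by rewrite (ordE x) (ordE y); apply: connect_trans (from0 y); rewrite csym.
have flips a (x : 'I_r) (j : 'I_n) : connect (qadj n d r) (a, x) (flip a j, x).
  have [y [i e]] := cidx_surj ndr (ltn_ord j).
  apply: connect_trans (level a x y) (connect_trans _ (level _ y x)); apply: connect1.
  by rewrite /qadj eqxx /= -e; apply/orP; right; apply/existsP; exists i.
move=> [a x] [b y]; apply: connect_trans (level b x y).
have [m] := ubnP #|[set k | a k != b k]|; elim: m a => // m IH a lt.
have [/setP e|[k]] := set_0Vmem [set k | a k != b k].
  suff -> : a = b by apply: connect0.
  by apply/ffunP => k; have := e k; rewrite !inE => /negbFE/eqP.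
move=> kD; apply: connect_trans (flips a x k) (IH _ _).
rewrite -ltnS; apply: leq_trans lt; rewrite !ltnS; apply/proper_card/properP; split.
  apply/subsetP => j; rewrite !inE ffunE; case: (val j =P k) => [e|_]; first by move: kD; rewrite inE (val_inj e).
  by case: (a j).
by exists k => //; move: kD; rewrite !inE ffunE eqxx; case: (a k); case: (b k).
Qed.

Theorem mainTheorem5 (n d r : nat) :
  0 < n -> 0 < d -> 0 < r -> 3 <= r -> 2 * d <= n ->
  (connected_graph (qadj n d r) /\ is_cayley_graph (qadj n d r)) <->
  n %| d * r.
Proof.
move=> n0 d0 r0 r3 dn; split=> [[conn cay]|nD]; last first.
  split; last exact: cayley_qadj.
  by apply: connected_qadj => //; apply: dvdn_leq => //; rewrite muln_gt0 d0.
have ndr := connected_dim r0 conn; apply: contraT => nD.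
have rE := divn_eq (d * r) n.
have s0 : 0 < (d * r) %% n by rewrite lt0n.
have sn : (d * r) %% n < n by rewrite ltn_mod.
have q0 : 0 < (d * r) %/ n by rewrite divn_gt0.
move: ((d * r) %% n) ((d * r) %/ n) rE s0 sn q0 => s q rE s0 sn q0.
have [t [t0 tr tE]] : exists t, [/\ 0 < t, 2 * t < r & d * t <= s /\ s < d * t + d \/ t = 1 /\ s < d].
  have [sd|ds] := ltnP s d; first by exists 1; split => //; right.
  have sE := divn_eq s d; have := ltn_pmod s d0; rewrite mulnC in sE => lt.
  exists (s %/ d); split; [by rewrite divn_gt0 | | by left; lia].
  (* [d * (2 * t) <= 2 * s < n + s <= q * n + s = d * r], where [q > 0] comes from connectedness. *)
  by rewrite -(ltn_pmul2l d0); nia.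
have := ltn_walks r0 d0 dn rE s0 sn t0 tr tE r3.
by rewrite (cayley_nwalks _ _ (zero_vec n, lev r0 0) cay) ltnn.
Qed.
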